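(* For every integer $d \ge 4$, we have $e(d) \ge \frac{2d-1}{3}$.
   Context: For a polynomial $P(x)$ with integer coefficients, its (naive) height $H(P)$ is the maximum of the absolute values of its coefficients. For a separable integer polynomial $P(x)$ of degree $d \ge 2$ with distinct complex roots $\alpha_1,\dots,\alpha_d$, set $\mathrm{sep}(P) = \min_{1\le i<j\le d} |\alpha_i - \alpha_j|$, and define the real number $e(P)$ by $\mathrm{sep}(P) = H(P)^{-e(P)}$. For $d \ge 2$, let $e(d) = \limsup e(P)$, where the limsup is taken over all separable integer polynomials $P(x)$ of degree $d$ as $H(P) \to +\infty$. *)

(* Defs.v *)
From HB Require Import structures.
From mathcomp Require Import all_boot all_order all_algebra all_field.
From mathcomp Require Import all_classical all_reals all_analysis.
From mathcomp Require Import complex.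

Set Implicit Arguments.
Unset Strict Implicit.
Unset Printing Implicit Defensive.

Import Order.TTheory GRing.Theory Num.Theory.
Import numFieldNormedType.Exports.

Local Open Scope classical_set_scope.
Local Open Scope complex_scope.
Local Open Scope ring_scope.

Definition height (P : {poly int}) : nat := \max_(i < size P) absz (P`_i)%R.

Definition polyCplx (R : realType) (P : {poly int}) : {poly R[i]} :=
  map_poly intr P.

Definition cdist (R : realType) (x y : R[i]) : R :=
  ComplexField.Normc.normc (x - y).

Definition root_dists (R : realType) (P : {poly int}) : set R :=
  [set r | exists x y : R[i],
    [/\ root (polyCplx R P) x, root (polyCplx R P) y, x != y & r = cdist x y]].
Arguments root_dists : clear implicits.

(* For separable P of degree at least 2 the infimum is a minimum over pairs of
   distinct roots: see root_sepP. *)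
Definition root_sep (R : realType) (P : {poly int}) : R :=
  inf (root_dists R P).

(* The solution e of root_sep P = H(P)^(-e): see sep_exponentP. It is
   only meaningful when H(P) > 1. *)
Definition sep_exponent (R : realType) (P : {poly int}) : R :=
  - ln (root_sep R P) / ln (height P)%:R.

Definition separable_deg (R : realType) (d : nat) : set {poly int} :=
  [set P : {poly int} | size P = d.+1 /\ separable_poly (polyCplx R P)].

(* The limsup as H(P) tends to infinity, taken in the extended reals, i.e. the
   infimum over N of the supremum over the P with H(P) >= N. *)
Definition e_deg (R : realType) (d : nat) : \bar R :=
  ereal_inf [set ereal_sup [set (sep_exponent R P)%:E |
      P in [set P | separable_deg R d P /\ (N <= height P)%N]]
    | N in [set: nat]].

Lemma seq_min_exists (R : realType) (l : seq R) : l != [::] ->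
  exists2 m, m \in l & {in l, forall x, m <= x}.
Proof.
elim: l => // a [_ _|b l IH _].
  by exists a; rewrite ?mem_head// => x; rewrite inE => /eqP ->.
have [//|m ml mmin] := IH.
have [am|ma] := leP a m.
  exists a; rewrite ?mem_head// => x; rewrite inE => /predU1P[->//|xl].
  exact: le_trans am (mmin _ xl).
exists m; first by rewrite inE ml orbT.
by move=> x; rewrite inE => /predU1P[->|]; [exact: ltW|exact: mmin].
Qed.

Lemma root_sepP (R : realType) (d : nat) (P : {poly int}) :
  (2 <= d)%N -> separable_deg R d P ->
  root_dists R P (root_sep R P) /\
  (forall r, root_dists R P r -> root_sep R P <= r).
Proof.
move=> d2 [szP sepP].
have [rs Prs] := closed_field_poly_normal (polyCplx R P).
have P0 : polyCplx R P != 0 by exact: separable_poly_neq0 sepP.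
have lc0 : lead_coef (polyCplx R P) != 0 by rewrite lead_coef_eq0.
have rootE x : root (polyCplx R P) x = (x \in rs).
  by rewrite Prs rootZ// root_prod_XsubC.
have urs : uniq rs.
  rewrite -separable_prod_XsubC.
  by apply: dvdp_separable sepP; rewrite [X in (_ %| X)%R]Prs dvdpZr.
have szrs : size rs = d.
  have := size_scale (\prod_(z <- rs) ('X - z%:P)) lc0.
  rewrite -Prs size_prod_XsubC => h; apply: succn_inj; rewrite -h -szP.
  by rewrite /polyCplx size_map_inj_poly//; exact: intr_inj.
pose l := [seq cdist p.1 p.2 | p <- [seq (x, y) | x <- rs, y <- rs] & p.1 != p.2].
have lE r : root_dists R P r <-> r \in l.
  split=> [[x [y [rx ry xy ->]]]|/mapP[[x y]]].
    apply/mapP; exists (x, y) => //; rewrite mem_filter xy.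
    by apply/allpairsP; exists (x, y); rewrite -!rootE.
  rewrite mem_filter => /andP[/= xy /allpairsP[[x' y'] [/= xr yr [ex ey]]]] ->.
  by exists x, y; rewrite !rootE ex ey; split=> //; rewrite -ex -ey.
have l0 : l != [::].
  move: urs szrs; case: (rs) @l lE => [|a [|b s]] l lE urs szrs; try by move: d2; rewrite -szrs.
  apply/eqP => lnil.
  suff : cdist a b \in l by rewrite lnil.
  apply/mapP; exists (a, b) => //; rewrite mem_filter; apply/andP; split.
    by move: urs => /= /andP[]; rewrite inE negb_or => /andP[].
  by apply/allpairsP; exists (a, b); rewrite !inE !eqxx orbT.
have [m ml mmin] := seq_min_exists l0.
suff -> : root_sep R P = m by split=> [|r /lE]; [exact/lE|exact: mmin].
apply/eqP; rewrite eq_le; apply/andP; split.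
  apply: ge_inf; last exact/lE.
  by exists m => r /lE; exact: mmin.
apply: lb_le_inf; first by exists m; exact/lE.
by move=> r /lE; exact: mmin.
Qed.

Lemma sep_exponentP (R : realType) (d : nat) (P : {poly int}) :
  (2 <= d)%N -> separable_deg R d P -> (1 < height P)%N ->
  root_sep R P = (height P)%:R `^ (- sep_exponent R P).
Proof.
move=> d2 dP hP; have [[x [y [_ _ xy sE]]] _] := root_sepP d2 dP.
have s0 : 0 < root_sep R P.
  rewrite sE lt_def; apply/andP; split.
    by apply: contra xy => /eqP /ComplexField.Normc.eq0_normc /eqP; rewrite subr_eq0.
  by rewrite /cdist; case: (x - y) => a b; exact: sqrtr_ge0.
have h0 : (height P)%:R != 0 :> R by rewrite pnatr_eq0 -lt0n (ltn_trans _ hP).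
have lnh : ln (height P)%:R != 0 :> R by rewrite gt_eqF// ln_gt0// ltr1n.
by rewrite /powR (negbTE h0) /sep_exponent -mulNr opprK divfK// lnK.
Qed.

(* Main.v *)
(** For an integer [a >= 1] let [Q_0 = 1], [Q_1 = 1 - a X] and
    [Q_(k+2) = Q_(k+1) - X^2 Q_k].  Then [Q_n] has degree [n] and height
    [O(a)], and with [q = a^2 + 1] it takes the value [q^(-n)] at [a / q],
    where its derivative has order [a].  Hence [(q X - a) Q_(d-1)] has degree
    [d] and height [H] between [a] and [O(a^3)], and two of its roots are at
    distance [O(a^(-2(d-1)-1)) = O(a^(-(2d-1)))], which gives the exponent
    [(2d-1)/3] as [a] tends to infinity.  The reversed polynomials
    [X^n Q_n(1/X)] satisfy a three-term recurrence of orthogonal polynomials,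
    so that a Christoffel-Darboux argument shows that all roots of [Q_n] are
    real and simple. *)

Require Import Defs.
From mathcomp Require Import all_boot all_order all_algebra.
From mathcomp Require Import all_classical all_reals all_analysis.
From mathcomp Require Import separable complex ring lra zify.

Set Implicit Arguments.
Unset Strict Implicit.
Unset Printing Implicit Defensive.

Import Order.TTheory GRing.Theory Num.Theory.

Local Open Scope ring_scope.

(** * The recurrence polynomials Q_n *)

Lemma nat_ind2 (P : nat -> Prop) :
  P 0%N -> P 1%N -> (forall n, P n -> P n.+1 -> P n.+2) -> forall n, P n.
Proof.
move=> P0 P1 PSS n; suff [] : P n /\ P n.+1 by [].
by elim: n => // n [Pn PSn]; split=> //; exact: PSS.
Qed.

(** The ring is a parameter because heights need integer coefficients and roots need complex
    ones. *)
Fixpoint qpoly (F : comNzRingType) (a : F) (n : nat) : {poly F} :=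
  match n with
  | 0 => 1
  | 1 => 1 - a%:P * 'X
  | (m.+1 as k).+1 => qpoly a k - 'X^2 * qpoly a m
  end.

Lemma qpolySS (F : comNzRingType) (a : F) n :
  qpoly a n.+2 = qpoly a n.+1 - 'X^2 * qpoly a n.
Proof. by []. Qed.

Lemma map_qpoly (F G : comNzRingType) (f : {rmorphism F -> G}) (a : F) n :
  map_poly f (qpoly a n) = qpoly (f a) n.
Proof.
elim/nat_ind2: n => [||n IH0 IH1]; first exact: rmorph1.
  by rewrite /= rmorphB rmorph1 rmorphM /= map_polyC map_polyX.
by rewrite !qpolySS rmorphB rmorphM /= map_polyXn IH0 IH1.
Qed.

Lemma qpoly_at0 (F : comNzRingType) (a : F) n : (qpoly a n).[0] = 1.
Proof.
elim/nat_ind2: n => [||n _ IH]; first by rewrite hornerC.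
  by rewrite /= !hornerE ?(mulr0, subr0).
by rewrite qpolySS hornerD hornerN hornerM IH hornerXn expr0n mul0r subr0.
Qed.

Lemma size_qpoly_le (F : comNzRingType) (a : F) n : (size (qpoly a n) <= n.+1)%N.
Proof.
elim/nat_ind2: n => [||n IH0 IH1]; first by rewrite size_polyC oner_eq0.
  apply: leq_trans (size_polyD _ _) _.
  rewrite size_polyN size_polyC oner_eq0 geq_max /= mul_polyC.
  by apply: leq_trans (size_scale_leq _ _) _; rewrite size_polyX.
rewrite qpolySS; apply: leq_trans (size_polyD _ _) _.
rewrite size_polyN geq_max (leq_trans IH1) //=.
by rewrite mulrC; apply: leq_trans (size_polyMleq _ _) _; rewrite size_polyXn; lia.
Qed.

Lemma size_qpoly (F : comNzRingType) (a : F) n : a != 0 -> size (qpoly a n) = n.+1.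
Proof.
move=> a0; suff lc : (qpoly a n)`_n != 0.
  apply/eqP; rewrite eqn_leq size_qpoly_le ltnNge; apply: contra lc => h.
  by rewrite nth_default.
elim/nat_ind2: n => [||n IH _]; first by rewrite coefC oner_eq0.
  by rewrite /= coefB coefCM coefX coefC mulr1 sub0r oppr_eq0.
rewrite qpolySS coefB nth_default ?size_qpoly_le // sub0r oppr_eq0.
by rewrite coefXnM /= subn2.
Qed.

(** * Value and derivative at a/q, where q = a^2 + 1 *)

(** For x = a/q, 1/q is a root of t^2 = t - x^2; the values start with 1 and 1/q, hence stay
    geometric. *)
Lemma qpoly_at_fraction (F : fieldType) (a : F) n : a ^+ 2 + 1 != 0 ->
  (qpoly a n).[a / (a ^+ 2 + 1)] = (a ^+ 2 + 1) ^- n.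
Proof.
move=> q0; elim/nat_ind2: n => [||n IH0 IH1].
- by rewrite hornerC expr0 invr1.
- by rewrite /= !hornerE /=; field.
rewrite qpolySS hornerD hornerN hornerM IH0 IH1 hornerXn.
rewrite (exprS _ n.+1) (exprS _ n).
by field; rewrite expf_neq0.
Qed.

Lemma deriv_qpolySS (F : comNzRingType) (a x : F) n :
  (qpoly a n.+2)^`().[x] = (qpoly a n.+1)^`().[x] - 2 * x * (qpoly a n).[x]
    - x ^+ 2 * (qpoly a n)^`().[x].
Proof. by rewrite qpolySS !poly.derivE !hornerE /=; ring. Qed.

(** From a at index 1, the opposite of the derivative gains a factor of at least a^2/q >= 1/2 at
    each step. *)
Lemma deriv_qpoly_at_fraction (F : numFieldType) (a : F) n : 1 <= a ->
  a / 2 ^+ n <= - (qpoly a n.+1)^`().[a / (a ^+ 2 + 1)].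
Proof.
move=> a1; have a0 : 0 < a := lt_le_trans ltr01 a1.
have q0 : 0 < a ^+ 2 + 1 by rewrite ltr_wpDl // exprn_ge0 // ltW.
have qn0 := lt0r_neq0 q0.
set q := a ^+ 2 + 1 in q0 qn0 *; set x := a / q.
pose E k := - (qpoly a k)^`().[x].
have xge0 : 0 <= x by rewrite divr_ge0 // ltW.
(* [1 / q] and [a ^+ 2 / q] are the roots of the characteristic equation
   [t ^+ 2 = t - x ^+ 2] of the recurrence. *)
have step k : E k.+2 - a ^+ 2 / q * E k.+1 =
    q^-1 * (E k.+1 - a ^+ 2 / q * E k) + 2 * x * q ^- k.
  rewrite /E deriv_qpolySS qpoly_at_fraction -/q // /x /q.
  by field; rewrite expf_neq0.
(* The right side minus the left is a at k = 0, and [step] keeps it nonnegative. *)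
have growth k : a ^+ 2 / q * E k <= E k.+1.
  elim: k => [|k IH].
    by rewrite /E /= !poly.derivE !hornerE /= oppr0 mulr0 opprK ltW.
  rewrite -subr_ge0 step addr_ge0 // mulr_ge0 ?invr_ge0 ?(ltW q0) ?subr_ge0 //.
    by rewrite mulr_ge0.
  by rewrite exprn_ge0 // ltW.
have half : 2^-1 <= a ^+ 2 / q.
  rewrite ler_pdivlMr // ler_pdivrMl ?ltr0n // mulr_natl mulr2n lerD2l.
  exact: exprn_ege1.
rewrite -/(E n.+1); elim: n => [|n IH].
  by rewrite /E /= !poly.derivE !hornerE /= expr0 divr1 opprK.
apply: le_trans (growth _); rewrite exprS invfM mulrCA.
by apply: ler_pM => //; rewrite ?invr_ge0 // divr_ge0 ?exprn_ge0 // ltW.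
Qed.

(** * Christoffel-Darboux identities and separability *)

(* The Christoffel-Darboux kernel of the reversed polynomials [X^k Q_k(1/X)],
   with denominators cleared. *)
Fixpoint cdkernel (F : comNzRingType) (a x z : F) (n : nat) : F :=
  if n is m.+1 then
    (qpoly a n).[x] * (qpoly a n).[z] + x * z * cdkernel a x z m
  else 1.

Lemma cdkernelS (F : comNzRingType) (a x z : F) n :
  cdkernel a x z n.+1 =
  (qpoly a n.+1).[x] * (qpoly a n.+1).[z] + x * z * cdkernel a x z n.
Proof. by []. Qed.

(** The recurrence at both points turns the left side at n + 1 into (z - x) Q_(n+1)(x) Q_(n+1)(z)
    plus x z times the left side at n. *)
Lemma christoffel_darboux (F : comNzRingType) (a x z : F) n :
  z * (qpoly a n.+1).[x] * (qpoly a n).[z] - x * (qpoly a n).[x] * (qpoly a n.+1).[z]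
  = (z - x) * cdkernel a x z n.
Proof.
elim: n => [|n IH]; first by rewrite /= !hornerE; ring.
rewrite cdkernelS mulrDr [_ * (x * z * _)]mulrCA -IH.
by rewrite qpolySS !hornerE /=; ring.
Qed.

(** This is the z-derivative of the previous identity at z = x, proved by a similar induction. *)
Lemma confluent_christoffel_darboux (F : comNzRingType) (a x : F) n :
  (qpoly a n).[x] * (qpoly a n.+1).[x] + x * (qpoly a n)^`().[x] * (qpoly a n.+1).[x]
  - x * (qpoly a n).[x] * (qpoly a n.+1)^`().[x] = cdkernel a x x n.
Proof.
elim: n => [|n IH]; first by rewrite /= !poly.derivE !hornerE /=; ring.
rewrite cdkernelS -IH deriv_qpolySS.
by rewrite qpolySS !hornerE /=; ring.
Qed.

(** As a is real, the kernel is the sum of |x|^(2(n-k)) |Q_k(x)|^2, whose term k = 0 is positive. *)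
Lemma cdkernel_conj_gt0 (C : numClosedFieldType) (a x : C) n : a \is Num.real ->
  x != 0 -> 0 < cdkernel a x x^* n.
Proof.
move=> /CrealP aR x0; elim: n => [|n IH]; first exact: ltr01.
rewrite cdkernelS.
have -> : (qpoly a n.+1).[x^*] = ((qpoly a n.+1).[x])^*.
  by rewrite -horner_map map_qpoly /= aR.
rewrite -!normCK ltr_wpDl ?exprn_ge0 // mulr_gt0 // exprn_gt0 //.
by rewrite normr_gt0.
Qed.

(* At a root [x], the kernel at [(x, conj x)] is positive, so the first identity
   forces [x] to be real and then the confluent one excludes a double root. *)
Lemma qpoly_separable (C : numClosedFieldType) (a : C) n : a \is Num.real ->
  separable_poly (qpoly a n).
Proof.
move=> aR; case: n => [|n]; first by rewrite unlock coprime1p.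
rewrite unlock; apply/Pdiv.ClosedField.coprimepP => x rx.
have x0 : x != 0.
  by apply: contraTneq rx => ->; rewrite /root qpoly_at0 oner_eq0.
have K0 := cdkernel_conj_gt0 n aR x0.
have rxc : (qpoly a n.+1).[x^*] = 0.
  have /CrealP <- := aR; rewrite -map_qpoly horner_map.
  by move/rootP: rx => ->; rewrite rmorph0.
have xR : x^* = x.
  have := christoffel_darboux a x x^* n; rewrite rxc (rootP rx) !mulr0 mul0r subr0.
  by move/esym/eqP; rewrite mulf_eq0 (gt_eqF K0) orbF subr_eq0 => /eqP.
apply/eqP => d0; move: K0; rewrite xR -confluent_christoffel_darboux.
by rewrite d0 (rootP rx) !mulr0 addr0 subr0 ltxx.
Qed.

(** * Distance from a point to the nearest root *)

(** p'/p is the sum of 1/(x - y) over the roots y, each term at most 1/r in modulus. The product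
    rule gives this without division, so p(x) = 0 and r = 0 are allowed. *)
Lemma deriv_le_root_distance (C : numClosedFieldType) (p : {poly C}) (x r : C) :
  0 <= r -> (forall y, root p y -> r <= `|x - y|) ->
  r * `|p^`().[x]| <= (size p).-1%:R * `|p.[x]|.
Proof.
move=> r0 far; have [rs prs] := closed_field_poly_normal p.
have [->|p0] := eqVneq p 0; first by rewrite derivC horner0 normr0 !mulr0.
have lc0 : lead_coef p != 0 by rewrite lead_coef_eq0.
have -> : (size p).-1 = size rs by rewrite prs size_scale // size_prod_XsubC.
have {}far : {in rs, forall y, r <= `|x - y|}.
  by move=> y yrs; apply: far; rewrite prs rootZ // root_prod_XsubC.
rewrite prs derivZ !hornerZ !normrM mulrCA [leRHS]mulrCA ler_wpM2l //.
elim: rs far {prs} => [|y s IH] far.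
  by rewrite big_nil derivC hornerC normr0 mulr0 mul0r.
have {}IH := IH (fun z zs => far z (@mem_behead _ (y :: s) z zs)).
rewrite big_cons derivM hornerD !hornerM !poly.derivE !hornerE.
have ry : r <= `|x - y| by apply: far; rewrite mem_head.
apply: le_trans (ler_wpM2l r0 (ler_normD _ _)) _.
rewrite mulrDr /= -[(size s).+1%:R]natr1 [leRHS]mulrDl mul1r addrC lerD //.
  by rewrite !normrM mulrCA [leRHS]mulrCA ler_wpM2l.
by rewrite normrM ler_wpM2r.
Qed.

(** * The family [close_poly]: height, separability, close roots *)

Definition close_poly (a n : nat) : {poly int} :=
  qpoly (a%:R : int) n * ((a%:R ^+ 2 + 1)%:P * 'X - (a%:R)%:P).

(** The factor a enters only through Q_1, so the bound stays linear in a and at most doubles at each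
    step. *)
Lemma normr_coef_qpoly (a n i : nat) : (0 < a)%N ->
  `|(qpoly (a%:R : int) n)`_i| <= (2 ^ n * a)%N%:R.
Proof.
move=> a0; elim/nat_ind2: n i => [i||n IH0 IH1 i].
- by rewrite coefC; case: i => [|i] /=; lia.
- by move=> [|[|i]]; rewrite /= coefB coefCM coefX coefC /=; lia.
rewrite qpolySS coefB coefXnM; have := IH1 i; have := IH0 (i - 2)%N.
rewrite !expnS -!mulnA; move: (2 ^ n * a)%N => v.
move: (qpoly _ n.+1)`_i (qpoly _ n)`_(i - 2) => x y.
by case: ifP => _; lia.
Qed.

Lemma height_close_poly_le (a n : nat) : (0 < a)%N ->
  (height (close_poly a n) <= 3 * 2 ^ n * a ^ 3)%N.
Proof.
move=> a0; apply/bigmax_leqP => -[i /= _] _; rewrite -lez_nat abszE.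
rewrite /close_poly mulrBr coefB mulrCA coefCM coefMX [_ * _%:P]mulrC coefCM.
have h j := normr_coef_qpoly n j a0.
set c := qpoly _ _ in h *.
apply: le_trans (ler_normB _ _) _; rewrite !normrM.
have e1 : `|a%:R ^+ 2 + 1 : int| * `|if (i == 0)%N then 0 else c`_i.-1| <=
    (a%:R ^+ 2 + 1) * (2 ^ n * a)%N%:R.
  apply: ler_pM => //; first by rewrite ger0_norm // -natrX -natrD1.
  by case: ifP => // _; rewrite normr0.
have e2 : `|a%:R : int| * `|c`_i| <= a%:R * (2 ^ n * a)%N%:R.
  by apply: ler_pM => //; rewrite ger0_norm.
apply: le_trans (lerD e1 e2) _.
rewrite -[leRHS]natz -natrX natr1 -!natrM -natrD ler_nat.
by move: (2 ^ n)%N => u; rewrite !expnS expn0; nia.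
Qed.

(** The constant coefficient is -a; heights thus tend to infinity with a. *)
Lemma height_close_poly_ge (a n : nat) : (a <= height (close_poly a n))%N.
Proof.
have [->//|a0] := posnP a.
have c0 : (close_poly a n)`_0 = - a%:R.
  by rewrite -horner_coef0 /close_poly hornerM qpoly_at0 !hornerE /= ?(mulr0, sub0r).
have s0 : (0 < size (close_poly a n))%N.
  rewrite lt0n size_poly_eq0; apply: contraTneq a0 => P0.
  by move: c0; rewrite P0 coef0; lia.
have := @leq_bigmax _ (fun i : 'I_(size (close_poly a n)) =>
  absz (close_poly a n)`_i) (Ordinal s0).
by rewrite /= c0 abszN natz.
Qed.

Lemma polyCplx_close_poly (R : realType) (a n : nat) :
  let q := a%:R ^+ 2 + 1 : R[i] in
  polyCplx R (close_poly a n) =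
  qpoly (a%:R : R[i]) n * (q *: ('X - (a%:R / q)%:P)).
Proof.
move=> q; have q0 : q != 0 by rewrite gt_eqF // ltr_wpDl // exprn_ge0.
rewrite /polyCplx /close_poly rmorphM /= map_qpoly /= rmorph_nat.
rewrite rmorphB rmorphM /= !map_polyC map_polyX /= rmorphD rmorphXn /= rmorph1.
by rewrite !rmorph_nat scalerBr -!mul_polyC -polyCM [q * (_ / _)]mulrC divfK // rmorph_nat.
Qed.

(** Both factors are separable, and they are coprime since Q_n is nonzero at a/q. *)
Lemma close_poly_separable (R : realType) (a n : nat) : (0 < a)%N ->
  separable_deg R n.+1 (close_poly a n).
Proof.
move=> a0; set q := a%:R ^+ 2 + 1 : R[i].
have q0 : q != 0 by rewrite gt_eqF // ltr_wpDl // exprn_ge0.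
have aF : (a%:R : R[i]) != 0 by rewrite pnatr_eq0 -lt0n.
split.
  have <- : size (polyCplx R (close_poly a n)) = size (close_poly a n).
    by rewrite size_map_inj_poly //; exact: intr_inj.
  rewrite polyCplx_close_poly -/q size_mul.
  - by rewrite size_scale // size_XsubC size_qpoly // addn2.
  - by rewrite -size_poly_eq0 size_qpoly.
  - by rewrite scaler_eq0 negb_or q0 polyXsubC_eq0.
rewrite polyCplx_close_poly -/q separable_mul qpoly_separable ?realn //=.
rewrite coprimepZr // coprimep_XsubC /root qpoly_at_fraction // invr_eq0.
rewrite expf_neq0 // andbT.
by rewrite unlock derivZ coprimepZl // coprimepZr // derivXsubC coprimep1.
Qed.

(** All roots of Q_(n+1) are at distance at least s, the separation, from the root a/q. Hence s a /
    2^n <= (n+1) q^(-(n+1)), and q >= a^2 gives the exponent 2(n+1) + 1. *)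
Lemma root_sep_close_poly (R : realType) (a n : nat) : (0 < a)%N ->
  0 < root_sep R (close_poly a n.+1)
    <= (n.+1%:R * 2 ^+ n) / a%:R ^+ (2 * n + 3).
Proof.
move=> a0; have [[x [y [_ _ xy sE]]] smin] :=
  root_sepP (isT : 2 <= 2 + n)%N (close_poly_separable R n.+1 a0).
set s := root_sep _ _ in sE smin *.
have normE (z : R[i]) : `|z| = (ComplexField.Normc.normc z)%:C%C by [].
have s0 : 0 < s.
  by rewrite sE -ltcR -normE normr_gt0 subr_eq0.
rewrite s0 /=; set q := a%:R ^+ 2 + 1 : R[i].
have qp : 0 < q by rewrite ltr_wpDl // exprn_ge0.
have q0 : q != 0 by rewrite gt_eqF.
have a1 : 1 <= (a%:R : R[i]) by rewrite ler1n.
have := @deriv_le_root_distance _ (qpoly (a%:R : R[i]) n.+1) (a%:R / q) s%:C%C.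
rewrite size_qpoly ?pnatr_eq0 -?lt0n // qpoly_at_fraction // -/q.
rewrite lecR (ltW s0) => /(_ isT) far.
have {}far : s%:C%C * `|(qpoly (a%:R : R[i]) n.+1)^`().[a%:R / q]|
    <= n.+1%:R * `|q ^- n.+1|.
  apply: far => z rz; rewrite normE lecR; apply: smin; exists (a%:R / q), z.
  rewrite polyCplx_close_poly -/q !rootM rz rootZ // root_XsubC eqxx orbT.
  split=> //; apply: contraTneq rz => <-.
  by rewrite /root qpoly_at_fraction // invr_eq0 expf_neq0.
have dE := deriv_qpoly_at_fraction n a1; rewrite -/q in dE.
have pow2 : 0 < 2 ^+ n :> R[i] by rewrite exprn_gt0 // ltr0n.
have aC : 0 < a%:R :> R[i] by rewrite ltr0n.
(* By [dE] the derivative is a nonpositive real, so its modulus is its opposite. *)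
rewrite ler0_norm in far; last first.
  by rewrite -oppr_ge0; apply: le_trans dE; rewrite divr_ge0 // ltW.
move: dE far; set D := - _ => dE.
rewrite ger0_norm ?invr_ge0 ?exprn_ge0 ?(ltW qp) // => far.
have q_ge : (a%:R ^+ 2) ^+ n.+1 <= q ^+ n.+1.
  by rewrite lerXn2r ?nnegrE ?lerDl ?exprn_ge0 ?(ltW qp) ?(ltW aC).
rewrite -lecR rmorphM fmorphV rmorphM !rmorphXn !rmorph_nat /=.
rewrite ler_pdivlMr ?exprn_gt0 //.
have -> : s%:C%C * a%:R ^+ (2 * n + 3) =
    (s%:C%C * (a%:R / 2 ^+ n)) * (a%:R ^+ 2) ^+ n.+1 * 2 ^+ n.
  rewrite -exprM (_ : 2 * n + 3 = (2 * n.+1).+1)%N; last by lia.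
  by rewrite exprS; field; rewrite gt_eqF.
rewrite ler_pM2r //.
have sC : 0 <= s%:C%C by rewrite lecR ltW.
apply: (@le_trans _ _ (n.+1%:R * q ^- n.+1 * q ^+ n.+1)); last first.
  by rewrite divfK // expf_neq0.
apply: ler_pM => //; rewrite ?mulr_ge0 ?exprn_ge0 ?invr_ge0 ?(ltW aC) ?(ltW pow2) //.
by apply: le_trans far; rewrite ler_wpM2l.
Qed.

(** * Asymptotics of the exponent *)

Lemma sep_exponent_close_poly (R : realType) (n : nat) (e : R) (N : nat) : 0 < e ->
  exists2 a, (N <= a)%N & (0 < a)%N /\
    (2 * n.+1%:R + 1) / 3 - e <= sep_exponent R (close_poly a n.+1).
Proof.
move=> e0; pose m : R := 2 * n.+1%:R + 1.
(* With L = ln a, the bounds below read ln s <= C1 - m L and ln h <= C2 + 3 L; the claim follows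
   once L >= K. *)
pose C1 := ln (n.+1%:R * 2 ^+ n : R); pose C2 := ln (3 * 2 ^+ n.+1 : R).
pose K := (C1 + m / 3 * C2) / e.
have [b bK] : exists b : nat, expR K <= b%:R.
  by exists (Num.truncn (expR K)).+1; exact/ltW/truncnS_gt.
(* Here [b] ensures ln a >= K, and 2 makes ln a positive. *)
exists (N + b + 2)%N; first by lia.
set a := (N + b + 2)%N; have a2 : (1 < a)%N by rewrite /a; lia.
have a0 : (0 < a)%N by exact: ltnW.
split=> //.
have aR : 0 < a%:R :> R by rewrite ltr0n.
have pn k : 0 < 2 ^+ k :> R by rewrite exprn_gt0.
set L := ln (a%:R : R).
have KL : K <= L.
  rewrite -[K]expRK ler_ln ?posrE ?expR_gt0 //; apply: le_trans bK _.
  by rewrite ler_nat /a; lia.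
have /andP[s0 sle] := root_sep_close_poly R n a0.
rewrite /sep_exponent; set s := root_sep _ _ in s0 sle *; set h := height _.
have ha : (a <= h)%N by exact: height_close_poly_ge.
have h0 : 0 < h%:R :> R by rewrite ltr0n (leq_trans a0).
have Lh : L <= ln (h%:R : R) by rewrite ler_ln ?posrE // ler_nat.
have L0 : 0 < L by rewrite ln_gt0 // ltr1n.
have hle : ln (h%:R : R) <= C2 + 3 * L.
  rewrite mulr_natl -lnXn // -lnM ?posrE ?mulr_gt0 ?exprn_gt0 //.
  rewrite ler_ln ?posrE ?mulr_gt0 ?exprn_gt0 //.
  by rewrite -!natrX -!natrM ler_nat height_close_poly_le.
have sl : ln s <= C1 - m * L.
  have -> : m * L = ln (a%:R ^+ (2 * n + 3) : R).
    by rewrite lnXn // -[RHS]mulr_natl /m; congr (_ * _); rewrite natrD natrM -natr1; ring.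
  rewrite -ln_div ?posrE ?mulr_gt0 ?exprn_gt0 ?ltr0n // ler_ln ?posrE //.
  by rewrite divr_gt0 ?mulr_gt0 ?exprn_gt0 ?ltr0n.
rewrite ler_pdivlMr; last exact: lt_le_trans Lh.
have m0 : 0 <= m / 3 by rewrite divr_ge0 // addr_ge0 // mulr_ge0.
have k1 : m / 3 * ln (h%:R : R) <= m / 3 * (C2 + 3 * L) by rewrite ler_wpM2l.
have k2 : e * L <= e * ln (h%:R : R) by rewrite ler_pM2l.
have k3 : C1 + m / 3 * C2 <= e * L by rewrite -ler_pdivrMl // mulrC.
rewrite -/m; lra.
Qed.

Theorem theorem1 (R : realType) (d : nat) (hd : (4 <= d)%N) :
  (((2 * d%:R - 1) / 3 : R)%:E <= e_deg R d)%E.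
Proof.
case: d hd => [|[|n]] // _.
(* For each threshold [N] and slack [e], one member of the family of height at least [N]
   suffices. *)
apply: le_ereal_inf_tmp => _ [N _ <-].
apply/lee_addgt0Pr => e e0.
have [a Na [a0 ae]] := sep_exponent_close_poly n N e0.
(* The degree is d = n + 2, so 2d - 1 = 2(n + 1) + 1. *)
have -> : (2 * n.+2%:R - 1) / 3 = ((2 * n.+1%:R + 1) / 3 - e) + e :> R.
  by rewrite subrK -(natr1 n.+1); congr (_ / _); ring.
rewrite EFinD leeD2r //.
apply: le_trans (ereal_sup_ubound _); last first.
  exists (close_poly a n.+1) => //; split; first exact: close_poly_separable.
  exact: leq_trans Na (height_close_poly_ge a n.+1).
by rewrite lee_fin.
Qed.
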